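(* Let $n\to\infty$, and let $N=N(n)$ be an integer with $N\ge ne^{2n}$ and $p=p(n)\in(0,1]$. The following hold asymptotically almost surely as $n\to\infty$. (i) If $p\ge N^{-\frac{2}{5n}}$, then $\frac1{16}nN\le \mathrm{ex}(G(N,p),P_{n+1})\le \frac12 nN$. (ii) Let $\omega=(\log N)/(np)$. If $N^{-1}\le p\le N^{-\frac{2}{5n}}$, then \[\frac{1}{75}\frac{\omega}{\log\omega}pnN\le \mathrm{ex}(G(N,p),P_{n+1})\le 8\frac{\omega}{\log\omega}pnN.\]
   Context: $G(N,p)$ denotes the Erdős–Rényi random graph on vertex set $[N]$ in which each pair is an edge independently with probability $p$. $P_k$ denotes the path on $k$ vertices. For graphs $G,F$, $\mathrm{ex}(G,F)$ is the maximum number of edges in an $F$-free subgraph of $G$. All logarithms are natural. ''Asymptotically almost surely'' means with probability tending to $1$ as $n\to\infty$. *)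

(* Defs.v *)
From HB Require Import structures.
From mathcomp Require Import all_boot all_order all_algebra.
From mathcomp Require Import all_classical all_reals all_analysis.
Set Implicit Arguments. Unset Strict Implicit. Unset Printing Implicit Defensive.
Import Order.TTheory GRing.Theory Num.Theory.
Local Open Scope ring_scope.

(* Graphs on vertex set [N] = 'I_N : an edge is a 2-element subset of 'I_N,
   a graph is identified with its edge set E : {set {set 'I_N}}. *)

Definition Kedges (N : nat) : {set {set 'I_N}} := [set e : {set 'I_N} | #|e| == 2%N].

Definition adj (N : nat) (F : {set {set 'I_N}}) (x y : 'I_N) : bool :=
  [set x; y] \in F.

Definition contains_path (N : nat) (F : {set {set 'I_N}}) (k : nat) : bool :=
  [exists t : k.-tuple 'I_N, uniq t && sorted (adj F) t].

Definition ex_path (N : nat) (E : {set {set 'I_N}}) (k : nat) : nat :=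
  \max_(F in powerset E | ~~ contains_path F k) #|F|.

(* Probability that G(N,p) satisfies the (boolean) property A:
   each of the C(N,2) pairs is an edge independently with probability p. *)
Definition Gnp_prob (R : realType) (N : nat) (p : R)
    (A : pred {set {set 'I_N}}) : R :=
  \sum_(E in powerset (Kedges N) | A E)
     p ^+ #|E| * (1 - p) ^+ (#|Kedges N| - #|E|).
Arguments Gnp_prob {R} N p A.

(* Main.v *)
(* Upper bounds. (i) is the Erdos-Gallai bound. For (ii), a depth-first search
   shows that a graph without a path on n+1 vertices has a rooted spanning forest
   of height less than n all of whose edges join a vertex to an ancestor; so it
   lies in one of N^N sets of at most nN pairs, and a Chernoff bound beats the
   union bound.

   Lower bounds. Put aside half of the vertices as centers, split into many groups
   of fewer than n/2 vertices. Each remaining vertex has, independently, a good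
   chance to see d vertices of some group; joining it to those d vertices of one
   such group gives components covered by fewer than n/2 vertices, hence without
   a path on n+1 vertices. Here d is of order n in (i) and of order
   log N / log omega in (ii). *)

Require Import Defs.
From HB Require Import structures.
From mathcomp Require Import all_boot all_order all_algebra.
From mathcomp Require Import all_classical all_reals all_analysis.
From mathcomp Require Import zify ring lra.
From mathcomp Require Import fintype finset.
Set Implicit Arguments. Unset Strict Implicit. Unset Printing Implicit Defensive.
Import Order.TTheory GRing.Theory Num.Theory.
Local Open Scope ring_scope.

(** * Random subsets *)

(** The factor [omega / ln omega] balances the union bound. A set of nN pairs carries about pnN
    edges, and a K-fold excess has probability about exp(-pnN K log K). This must pay for N^N =
    exp(N log N) parent functions; as N log N = omega pnN, K log K has to be of order omega.

    In the lower bound a single group succeeds only with tiny probability. Since log N >= 2n, sqrt N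
    far exceeds n, so with at least about N/n groups a success probability N^(-1/2) per group
    already makes a leaf good with constant probability. All but the sparsest case aim at this
    threshold. The exponent 2/(5n) separates two ways to reach it: above it, p^d >= N^(-1/5) for
    every d < n/2; below it, log omega >= (2/5) log N / n, so [D = L / ln omega] is at most 5n/2,
    and d <= D/8 blocks fit into fewer than n/2 vertices. *)

Section RandomSet.
Variables (R : realType) (T : finType) (p : R).
Implicit Types (l : seq T) (g h : {set T} -> R) (A : {set T} -> bool).

(* The elements of [l] are revealed one by one, each kept with probability [p]. *)
Fixpoint expect l g : R :=
  if l is e :: l' then p * expect l' (fun E => g (e |: E)) + (1 - p) * expect l' g
  else g set0.

Definition prob l A := expect l (fun E => (A E)%:R).

Lemma eq_expect l g h : g =1 h -> expect l g = expect l h.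
Proof.
elim: l g h => [|e l IH] g h gh /=; first exact: gh.
by rewrite (IH _ _ gh) (IH _ (fun E => h (e |: E))) // => E; apply: gh.
Qed.

(** Ties the recursion to the closed formula of [Gnp_prob]. Repetitions are excluded because a
    repeated element would get two chances to be kept. *)
Lemma expect_sum l g : uniq l ->
  expect l g = \sum_(E : {set T} | E \subset l)
     p ^+ #|E| * (1 - p) ^+ (size l - #|E|) * g E.
Proof.
elim: l g => [|e l IH] g /=.
  rewrite (big_pred1 set0) ?cards0 ?mul1r // => E /=.
  by rewrite -subset0; apply: eq_subset_r => x; rewrite !inE.
move=> /andP[el ul]; rewrite !IH // [RHS](bigID (fun E : {set T} => e \in E)) /=.
have cardl (E : {set T}) : E \subset l -> (#|E| <= size l)%N.
  by move=> /subset_leq_card h; apply: leq_trans h (card_size _).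
have subl (E : {set T}) : e \notin E -> (E \subset e :: l) = (E \subset l).
  move=> eE; apply/subsetP/subsetP => h x xE; have := h x xE.
    by rewrite inE; case: eqP => [xe|//]; move: eE; rewrite -xe xE.
  by rewrite inE => ->; rewrite orbT.
have subU (E : {set T}) : e \notin E -> (e |: E \subset e :: l) = (E \subset l).
  move=> /subl <-; apply/subsetP/subsetP => h x xE.
    by apply: h; rewrite inE xE orbT.
  by move: xE; rewrite in_setU1 => /orP[/eqP->|/h //]; rewrite inE eqxx.
congr (_ + _).
  rewrite [RHS](reindex_onto (fun E => e |: E) (fun E => E :\ e)) /=; last first.
    by move=> E /andP[_ eE]; rewrite setD1K.
  rewrite big_distrr /=; apply: eq_big => [E|E El].
    apply/idP/idP => [El|].
      have eE : e \notin E by apply: contra el => /(subsetP El).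
      by rewrite setU1K // eqxx setU11 !andbT subU.
    move=> /andP[/andP[h _] /eqP hE].
    have eE : e \notin E by rewrite -hE !inE eqxx.
    by rewrite -subU.
  have eE : e \notin E by apply: contra el => /(subsetP El).
  by rewrite cardsU1 eE add1n subSS exprS !mulrA.
rewrite big_distrr /=; apply: eq_big => [E|E El].
  have [eE|eE] := boolP (e \in E); last by rewrite andbT subl.
  by rewrite andbF; apply: contraNF el => /subsetP; apply.
by rewrite subSn ?cardl // exprS; ring.
Qed.

Lemma expectZ l c g : expect l (fun E => c * g E) = c * expect l g.
Proof. by elim: l g => [|e l IH] g //=; rewrite !IH; ring. Qed.

Lemma expectD l g h : expect l (fun E => g E + h E) = expect l g + expect l h.
Proof.
elim: l g h => [|e l IH] g h //=.
by rewrite !IH; ring.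
Qed.

Lemma expect_cst l c : expect l (fun=> c) = c.
Proof. by elim: l => [|e l IH] //=; rewrite IH; ring. Qed.

Lemma expect_le l g h : 0 <= p <= 1 -> (forall E, g E <= h E) ->
  expect l g <= expect l h.
Proof.
move=> /andP[p0 p1]; elim: l g h => [|e l IH] g h gh //=.
by rewrite lerD // ler_wpM2l ?subr_ge0 // IH.
Qed.

(** Independence is expressed below by asking that each [e] be ignored by one of the two functions,
    which avoids naming the sets of edges they depend on. *)
Definition insens (X : Type) (g : {set T} -> X) e := forall E, g (e |: E) = g E.

Lemma insensU (X : Type) (g : {set T} -> X) e e' :
  insens g e -> insens (fun E => g (e' |: E)) e.
Proof. by move=> gi E; rewrite setUCA gi. Qed.

(** When [e] is revealed, the factor ignoring it has the same expectation in both branches and can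
    be pulled out. *)
Lemma expectM l g h : (forall e, insens g e \/ insens h e) ->
  expect l (fun E => g E * h E) = expect l g * expect l h.
Proof.
elim: l g h => [|e l IH] g h gh //=.
have h1 : forall g' h', (forall e', insens g e' -> insens g' e') ->
   (forall e', insens h e' -> insens h' e') ->
   expect l (fun E => g' E * h' E) = expect l g' * expect l h'.
  by move=> g' h' gg hh; apply: IH => e'; case: (gh e') => /[dup] ? => [/gg|/hh]; tauto.
rewrite (h1 g h) // (h1 (fun E => g (e |: E)) (fun E => h (e |: E))); last first.
- by move=> ?; apply: insensU.
- by move=> ?; apply: insensU.
case: (gh e) => ie.
  have -> : expect l (fun E => g (e |: E)) = expect l g by apply: eq_expect.
  ring.
have -> : expect l (fun E => h (e |: E)) = expect l h by apply: eq_expect.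
ring.
Qed.

Lemma expect_prod (I : eqType) (r : seq I) l (g : I -> {set T} -> R) : uniq r ->
    (forall e i j, i \in r -> j \in r -> i != j -> insens (g i) e \/ insens (g j) e) ->
  expect l (fun E => \prod_(i <- r) g i E) = \prod_(i <- r) expect l (g i).
Proof.
elim: r => [|i r IH] /= ur gr.
  by rewrite big_nil -[RHS](expect_cst l); apply: eq_expect => E; rewrite big_nil.
have /andP[ir ur'] := ur.
rewrite big_cons -IH // => [|e a b ar br]; last first.
  by apply: gr; rewrite inE (ar, br) orbT.
rewrite -expectM => [|e]; first by apply: eq_expect => E; rewrite big_cons.
(* If [g i] reads [e], the pairwise condition forces every other factor, hence their product, to
   ignore [e]. *)
have [?|ni] := pselect (insens (g i) e); first by left.
right=> E; apply: eq_big_seq => j jr.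
have ij : i != j by apply: contraNneq ir => ->.
by have [| |//|/ni|->] := gr e i j; rewrite ?inE ?eqxx ?jr ?orbT.
Qed.

Lemma eq_prob l A A' : A =1 A' -> prob l A = prob l A'.
Proof. by move=> AA; apply: eq_expect => E; rewrite AA. Qed.

Lemma prob_compl l A : prob l (fun E => ~~ A E) = 1 - prob l A.
Proof.
apply/eqP; rewrite eq_sym subr_eq -expectD -[X in X == _](expect_cst l); apply/eqP.
by apply: eq_expect => E; case: (A E); rewrite ?addr0 ?add0r.
Qed.

Lemma prob_forall (I : finType) l (A : I -> {set T} -> bool) :
    (forall e i j, i != j -> insens (A i) e \/ insens (A j) e) ->
  prob l (fun E => [forall i, A i E]) = \prod_i prob l (A i).
Proof.
move=> hA; rewrite /prob -(@expect_prod _ _ l (fun i E => (A i E)%:R)) ?index_enum_uniq //.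
  apply: eq_expect => E; have [/forallP h|] := boolP [forall i, A i E].
    by rewrite big1 // => i _; rewrite h.
  rewrite negb_forall => /existsP[i nAi].
  by rewrite (bigD1 i) //= (negbTE nAi) mul0r.
move=> e i j _ _ /(hA e)[] h; [left|right] => E; by rewrite h.
Qed.

Lemma prob_exists (I : finType) l (A : I -> {set T} -> bool) :
    (forall e i j, i != j -> insens (A i) e \/ insens (A j) e) ->
  prob l (fun E => [exists i, A i E]) = 1 - \prod_i (1 - prob l (A i)).
Proof.
move=> hA; under [in RHS]eq_bigr do rewrite -prob_compl.
rewrite -prob_forall => [|e i j /(hA e)[] h]; last first.
- by right=> E; rewrite h.
- by left=> E; rewrite h.
rewrite -prob_compl; apply: eq_prob => E.
by rewrite negb_forall; apply: eq_existsb => i; rewrite negbK.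
Qed.

Lemma prob_le l A A' : 0 <= p <= 1 -> (forall E, A E -> A' E) -> prob l A <= prob l A'.
Proof.
by move=> p01 AA; apply: expect_le => // E; rewrite ler_nat; case: (A E) (AA E) => // ->.
Qed.

Lemma prob_or l A A' : 0 <= p <= 1 ->
  prob l (fun E => A E || A' E) <= prob l A + prob l A'.
Proof.
move=> p01; rewrite -expectD; apply: expect_le => // E; rewrite -natrD ler_nat.
by case: (A E); case: (A' E).
Qed.

Lemma prob_exists_le (I : finType) l (A : I -> {set T} -> bool) : 0 <= p <= 1 ->
  prob l (fun E => [exists i, A i E]) <= \sum_i prob l (A i).
Proof.
move=> p01.
have -> : \sum_i prob l (A i) = expect l (fun E => \sum_i (A i E)%:R).
  elim: (index_enum I) => [|i r IH].
    by rewrite big_nil -[LHS](expect_cst l); apply: eq_expect => E; rewrite big_nil.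
  by rewrite big_cons IH -expectD; apply: eq_expect => E; rewrite big_cons.
apply: expect_le => // E; case: existsP => [[i Ai]|_]; last by rewrite sumr_ge0.
by rewrite (bigD1 i) //= Ai lerDl sumr_ge0.
Qed.

Lemma prob_mem l e : uniq l -> prob l (fun E => e \in E) = p *+ (e \in l).
Proof.
rewrite /prob; elim: l => [|e' l IH] /=; first by rewrite inE.
move=> /andP[e'l ul]; rewrite IH //= inE.
have [->|ne] := eqVneq e e'.
  rewrite (negbTE e'l) mulr0n mulr0 addr0 (@eq_expect l _ (fun=> 1)) ?expect_cst ?mulr1 // => E.
  by rewrite setU11.
rewrite (@eq_expect l _ (fun E => (e \in E)%:R)) ?IH // => [|E]; first by ring.
by rewrite in_setU1 (negbTE ne).
Qed.

(** Covers [e] outside [l] too, such as the degenerate one-element sets that [ancestor_pairs] may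
    contain. *)
Lemma prob_mem_le l e : 0 <= p -> uniq l -> prob l (fun E => e \in E) <= p.
Proof. by move=> p0 ul; rewrite prob_mem //; case: (_ \in _). Qed.

(* Markov's inequality for [y ^ #|E :&: C|]. *)
Lemma prob_card_ge l (C : {set T}) (y m : R) : 0 <= p <= 1 -> uniq l -> 1 <= y ->
  prob l (fun E => m <= #|E :&: C|%:R) <= y `^ (- m) * expR (y * p * #|C|%:R).
Proof.
move=> p01 ul y1; have p0 : 0 <= p by case/andP: p01.
have y0 : 0 < y by apply: lt_le_trans y1.
(* As a product of factors reading one element each, the power has a factorizing expectation; each
   factor has mean at most 1 + (y - 1) p <= e^(yp). *)
apply: (@le_trans _ _ (y `^ (- m) * expect l (fun E => \prod_(e in C) (1 + (y - 1) * (e \in E)%:R)))).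
  rewrite -expectZ; apply: expect_le => // E.
  have -> : \prod_(e in C) (1 + (y - 1) * (e \in E)%:R) = y `^ #|E :&: C|%:R.
    rewrite powR_mulrn ?ltW // -[RHS]prodr_const.
    rewrite [LHS](bigID (mem E)) /= [X in _ * X]big1 => [|e /andP[_ /negbTE ->]]; last first.
      by rewrite mulr0 addr0.
    rewrite mulr1; apply: eq_big => [e|e /andP[_ ->]]; first by rewrite inE andbC.
    by rewrite mulr1 addrC subrK.
  rewrite -powRD; last by rewrite (gt_eqF y0) implybT.
  case: (lerP m _) => h; last exact: powR_ge0.
  apply: (@le_trans _ _ (y `^ 0)); first by rewrite powRr0.
  by rewrite ler_powR // addrC subr_ge0.
rewrite ler_wpM2l ?powR_ge0 //.
rewrite (@eq_expect l _ (fun E => \prod_(e <- enum C) (1 + (y - 1) * (e \in E)%:R))); last first.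
  by move=> E; rewrite big_enum.
rewrite expect_prod ?enum_uniq //; last first.
  move=> e i j _ _ ij; have [->|ei] := eqVneq e i.
    by right=> E; rewrite in_setU1 eq_sym (negbTE ij).
  by left=> E; rewrite in_setU1 eq_sym (negbTE ei).
rewrite big_enum /=.
have -> : expR (y * p * #|C|%:R) = \prod_(e in C) expR (y * p).
  by rewrite prodr_const -expRM_natr.
apply: ler_prod => e _; rewrite expectD expect_cst expectZ.
have h0 : 0 <= prob l (fun E => e \in E).
  by rewrite -(expect_cst l 0); apply: expect_le.
have h1 := prob_mem_le e p0 ul.
have y10 : 0 <= y - 1 by rewrite subr_ge0.
rewrite addr_ge0 ?mulr_ge0 //=.
apply: le_trans (expR_ge1Dx _); rewrite lerD2l.
apply: (@le_trans _ _ ((y - 1) * p)); first by rewrite ler_wpM2l.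
by rewrite ler_wpM2r // gerBl.
Qed.

End RandomSet.

(** * Graphs without long paths *)

Section Paths.
Local Open Scope nat_scope.

Variables (N n : nat) (F : {set {set 'I_N}}).
Hypothesis F2 : F \subset Kedges N.
Hypothesis noP : ~~ contains_path F n.+1.

Lemma adj_sym : symmetric (adj F).
Proof. by move=> x y; rewrite /adj setUC. Qed.

Lemma card_edge e : e \in F -> #|e| = 2.
Proof. by move/(subsetP F2); rewrite inE => /eqP. Qed.

Lemma adj_neq x y : adj F x y -> x != y.
Proof. by move/card_edge; rewrite cards2; case: eqP. Qed.

Lemma edgeP e : e \in F -> exists x y, e = [set x; y] /\ adj F x y.
Proof.
move=> eF; have /eqP/cards2P[x [y [_ eE]]] := card_edge eF.
by exists x, y; rewrite /adj -eE.
Qed.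

Lemma path_size (s : seq 'I_N) : uniq s -> sorted (adj F) s -> size s <= n.
Proof.
move=> us ss; rewrite leqNgt; apply: contra noP => ltn.
have st : size (take n.+1 s) == n.+1 by rewrite size_take_min; lia.
apply/existsP; exists (Tuple st); rewrite /= take_uniq //=.
exact: take_sorted.
Qed.

(** * The Erdos-Gallai bound *)

Definition edges_in (U : {set 'I_N}) := [set e in F | e \subset U].
Definition degree_in (U : {set 'I_N}) x := #|[set y in U | adj F x y]|.

Lemma edges_in_rem (U : {set 'I_N}) x :
  #|edges_in U| <= #|edges_in (U :\ x)| + degree_in U x.
Proof.
have sub : edges_in U \subset edges_in (U :\ x) :|:
    [set [set x; y] | y in [set y in U | adj F x y]].
  apply/subsetP => e; rewrite !inE => /andP[eF eU].
  have [xe|xe] := boolP (x \in e); last by rewrite eF subsetD1 eU xe.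
  apply/orP; right; have [a [b [eE ab]]] := edgeP eF.
  move: xe eU; rewrite eE !inE subUset !sub1set => /orP[] /eqP -> /andP[aU bU].
    by apply/imsetP; exists b => //; rewrite inE bU.
  by apply/imsetP; exists a; rewrite ?inE ?aU 1?adj_sym // setUC.
apply: leq_trans (subset_leq_card sub) _; rewrite cardsU.
apply: leq_trans (leq_subr _ _) _.
by rewrite leq_add2l; apply: leq_imset_card.
Qed.

Definition path_in (U : {set 'I_N}) (s : seq 'I_N) :=
  [&& uniq s, sorted (adj F) s & all [in U] s].

Lemma longest_path (U : {set 'I_N}) x : x \in U ->
  exists s, [/\ path_in U s, 0 < size s &
    forall s', path_in U s' -> size s' <= size s].
Proof.
move=> xU.
pose Q k := [exists t : k.-tuple 'I_N, path_in U t].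
have Qs s : path_in U s -> Q (size s).
  by move=> h; apply/existsP; exists (in_tuple s).
have Q1 : Q 1 by apply: (Qs [:: x]); rewrite /path_in /= xU.
have Qn k : Q k -> k <= n.
  by case/existsP => t /and3P[ut st _]; rewrite -(size_tuple t); apply: path_size.
case: (ex_maxnP (ex_intro Q 1 Q1) Qn) => k /existsP[t ht] kmax.
exists t; rewrite size_tuple; split => //; first exact: kmax.
by move=> s' /Qs/kmax.
Qed.

(* Posa crossing: the neighbours of both ends lie on the path, so if the two
   degrees sum to at least its length, the path closes up to a cycle. *)
Lemma longest_path_cycle (U : {set 'I_N}) s :
    (forall x, x \in U -> n < 2 * degree_in U x) ->
    path_in U s -> 0 < size s ->
    (forall s', path_in U s' -> size s' <= size s) ->
  exists c, [/\ uniq c, cycle (adj F) c, size c = size s & all [in U] c].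
Proof.
move=> degU ps s0 smax; have /and3P[us ss sU] := ps.
case: s => // x s in us ss sU ps s0 smax *.
set y := last x s; set m := size s.
have szn : m < n.+1 by have := path_size us ss; rewrite /= /m; lia.
have xU : x \in U by move: sU => /= /andP[].
have yU : y \in U by move/allP: sU; apply; apply: mem_last.
(* [A] is indexed along [s] and [B] along [x :: s], so a common [i] gives consecutive path vertices
   v, w with v ~ y and x ~ w. There are at most n - 1 indices, while the two degrees sum to more
   than n. *)
pose A := [set i : 'I_m | adj F x (nth x s i)].
pose B := [set i : 'I_m | adj F (nth x (x :: s) i) y].
have dA : degree_in U x <= #|A|.
  apply: leq_trans (leq_imset_card (fun i : 'I_m => nth x s i) A).
  apply: subset_leq_card; apply/subsetP => z; rewrite inE => /andP[zU xz].
  have zs : z \in s.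
    have : z \in x :: s.
      apply/negPn/negP => zs.
      have : path_in U (z :: x :: s).
        by rewrite /path_in cons_uniq zs us /= adj_sym xz zU; move: ss sU => /= -> ->.
      by move/smax; rewrite /= ltnn.
    by rewrite inE eq_sym (negbTE (adj_neq xz)).
  have iz : index z s < m by rewrite index_mem.
  by apply/imsetP; exists (Ordinal iz); rewrite ?inE /= nth_index.
have dB : degree_in U y <= #|B|.
  apply: leq_trans (leq_imset_card (fun i : 'I_m => nth x (x :: s) i) B).
  apply: subset_leq_card; apply/subsetP => z; rewrite inE => /andP[zU yz].
  have zs : z \in x :: s.
    apply/negPn/negP => zs.
    have : path_in U (rcons (x :: s) z).
      rewrite /path_in rcons_uniq zs us /= rcons_path yz all_rcons /= zU.
      by move: ss sU => /= -> ->.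
    by move/smax; rewrite size_rcons ltnn.
  have zB : z \in belast x s.
    by move: zs; rewrite lastI mem_rcons inE eq_sym (negbTE (adj_neq yz)).
  have iz : index z (belast x s) < m by rewrite -[m](size_belast x s) index_mem.
  have zE : nth x (x :: s) (index z (belast x s)) = z.
    by rewrite lastI nth_rcons size_belast iz nth_index.
  by apply/imsetP; exists (Ordinal iz); rewrite ?inE /= zE // adj_sym.
have : 0 < #|A :&: B|.
  have := cardsUI A B; have := max_card (A :|: B); rewrite card_ord.
  by have := degU x xU; have := degU y yU; lia.
case/card_gt0P => i; rewrite !inE => /andP[xi iy].
have im := ltn_ord i.
pose s1 := take i s; pose s2 := drop i s.
have sE : s = s1 ++ s2 by rewrite cat_take_drop.
have s2E : s2 = nth x s i :: drop i.+1 s by rewrite /s2 (drop_nth x).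
have l1 : last x s1 = nth x (x :: s) i.
  by rewrite (last_nth x) size_takel ?(ltnW im) // -[x :: s1]/(take i.+1 (x :: s)) nth_take.
have ly : last (nth x s i) (drop i.+1 s) = y 
  by rewrite /y -[in RHS](cat_take_drop i s) last_cat -/s2 s2E.
have hp : perm_eq (x :: s1 ++ rev s2) (x :: s).
  by rewrite perm_cons -[X in perm_eq _ X](cat_take_drop i s) perm_cat2l perm_rev.
(* Follow the path from [x] to v, jump to [y], walk back to w and return to [x]. *)
exists (x :: s1 ++ rev s2); split.
- by rewrite (perm_uniq hp).
- rewrite /= rcons_cat cat_path.
  move: ss; rewrite /= {1}sE cat_path => /andP[-> /=].
  rewrite s2E /= l1 => /andP[_ p2].
  rewrite -rev_cons.
  have -> : rev [:: x, nth x s i & drop i.+1 s] = y :: rev (belast x (nth x s i :: drop i.+1 s)).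
    by rewrite lastI rev_rcons /= ly.
  rewrite /= iy /=.
  have -> : path (adj F) y (rev [:: x & belast (nth x s i) (drop i.+1 s)]) =
     path (adj F) x (nth x s i :: drop i.+1 s).
    rewrite -[in RHS](rev_path) /= ly.
    by apply: eq_path => a b; rewrite adj_sym.
  by rewrite /= xi p2.
- by rewrite (perm_size hp).
- by rewrite (perm_all _ hp).
Qed.

Lemma edges_in_split (U C : {set 'I_N}) :
    (forall x y, x \in C -> y \in U -> adj F x y -> y \in C) ->
  #|edges_in U| <= #|edges_in (U :\: C)| + 'C(#|C|, 2).
Proof.
move=> hC.
rewrite -cards_draws.
have sub : edges_in U \subset edges_in (U :\: C) :|:
    [set e : {set 'I_N} | e \subset C & #|e| == 2].
  apply/subsetP => e; rewrite !inE => /andP[eF eU].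
  rewrite eF (card_edge eF) eqxx andbT /=.
  have [a [b [eE ab]]] := edgeP eF.
  move: eU; rewrite eE !subUset !sub1set !inE => /andP[aU bU]; rewrite aU bU !andbT.
  have [aC|aC] := boolP (a \in C); first by rewrite (hC a b).
  have [bC|bC] := boolP (b \in C) => //=.
  by move: aC; rewrite (hC b a) // adj_sym.
apply: leq_trans (subset_leq_card sub) _; rewrite cardsU; exact: leq_subr.
Qed.

(** Induction on the size of [U]. A vertex of degree at most n/2 can be deleted. Otherwise a longest
    path closes to a cycle; an edge leaving the cycle would open it to a longer path, so its s <= n
    vertices are cut off from the rest of [U], span at most s(s-1)/2 <= ns/2 edges, and can be
    deleted together. *)
Lemma edges_in_le (U : {set 'I_N}) : 2 * #|edges_in U| <= n * #|U|.
Proof.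
have [m] := ubnP #|U|; elim: m U => // m IH U ltm.
have [->|[x0 x0U]] := set_0Vmem U.
  suff -> : edges_in set0 = set0 by rewrite !cards0 !muln0.
  apply/setP => e; rewrite !inE subset0; apply/negP => /andP[/card_edge e2 /eqP e0].
  by rewrite e0 cards0 in e2.
have [/exists_inP[x xU dx]|/exists_inPn hd] :=
    boolP [exists x in U, 2 * degree_in U x <= n].
  have := edges_in_rem U x; have := cardsD1 x U; rewrite xU => UE.
  have := IH (U :\ x); rewrite UE mulnDr; lia.
have degU x : x \in U -> n < 2 * degree_in U x by move/hd; rewrite ltnNge.
have [s [ps s0 smax]] := longest_path x0U.
have [c [uc cc sc cU]] := longest_path_cycle degU ps s0 smax.
have sn : size s <= n by case/and3P: ps => ? ? _; apply: path_size.
pose C := [set z in c].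
have cardC : #|C| = size s by rewrite cardsE (card_uniqP uc).
have CU : C \subset U by apply/subsetP => z; rewrite inE => /(allP cU).
have hC x y : x \in C -> y \in U -> adj F x y -> y \in C.
  rewrite !inE => xc yU xy; apply/negPn/negP => yc.
  have [i r rE] := rot_to xc.
  have : path_in U (y :: x :: r).
    have : perm_eq (x :: r) c by rewrite -rE perm_rot.
    move=> pe; rewrite /path_in cons_uniq (perm_mem pe) yc (perm_uniq pe) uc /=.
    have : all [in U] (x :: r) by rewrite (perm_all _ pe).
    move=> /= ->; rewrite yU adj_sym xy /= andbT.
    by move: cc; rewrite -(rot_cycle i) rE /= rcons_path => /andP[].
  move/smax => /=; by rewrite -sc -[size c](size_rot i) rE /= ltnn.
have := edges_in_split hC; have := IH (U :\: C).
rewrite cardsD (setIidPr CU) cardC bin2.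
have := subset_leq_card CU; rewrite cardC.
have : (size s * (size s).-1)./2.*2 <= n * size s.
  have := odd_double_half (size s * (size s).-1); nia.
move=> h1 sU h2 h3.
have UE : n * #|U| = n * (#|U| - size s) + n * size s by rewrite -mulnDr subnK.
have {}h2 : 2 * #|edges_in (U :\: C)| <= n * (#|U| - size s) 
  by apply: h2; rewrite ltn_subLR // (leq_trans ltm) // -add1n leq_add2r.
rewrite UE; apply: leq_trans (leq_add h2 h1).
by rewrite -mul2n -mulnDr leq_pmul2l.
Qed.

Lemma erdos_gallai : 2 * #|F| <= n * N.
Proof.
have := edges_in_le [set: 'I_N]; rewrite cardsT card_ord.
suff -> : edges_in [set: 'I_N] = F by [].
by apply/setP => e; rewrite !inE subsetT andbT.
Qed.

(** * Depth-first search and ancestor pairs *)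

Definition covered (f : 'I_N -> 'I_N) x y :=
  exists2 j, j < n & iter j.+1 f x = y \/ iter j.+1 f y = x.

(** Lets the search assign a parent to a new vertex without disturbing the ancestors of the visited
    ones, which form a closed set. *)
Lemma eq_in_iter (f f' : 'I_N -> 'I_N) (W : pred 'I_N) x j :
    (forall z, W z -> W (f z)) -> (forall z, W z -> f' z = f z) -> W x ->
  iter j f' x = iter j f x.
Proof.
move=> Wf ff Wx; have WI i : W (iter i f x) by elim: i => //= i; apply: Wf.
by elim: j => //= j ->; rewrite ff.
Qed.

(* State of a depth-first search: [Z] is the set of finished vertices, [s] the
   stack (top first), and [f] the parent function. *)
Lemma dfs_complete m (Z : {set 'I_N}) (s : seq 'I_N) (f : 'I_N -> 'I_N) :
    uniq s -> {in s, forall x, x \notin Z} -> sorted (adj F) s -> sorted (frel f) s ->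
    (forall x, (x \in Z) || (x \in s) -> (f x \in Z) || (f x \in s)) ->
    (forall x y, x \in Z -> adj F x y -> ((y \in Z) || (y \in s)) /\ covered f x y) ->
    2 * #|~: Z| <= m + size s ->
  exists f', forall x y, adj F x y -> covered f' x y.
Proof.
(* The quantity 2 [#|~: Z|] - [size s] drops by one per move: a push lengthens [s], a pop shortens
   [s] and enlarges [Z]. At [m = 0] every vertex is finished, because [s] lies outside [Z]. *)
elim: m Z s f => [|m IH] Z s f us sZ ss sf cl cov mle.
  have : size s <= #|~: Z|.
    rewrite -(card_uniqP us); apply: subset_leq_card; apply/subsetP => x xs.
    by rewrite inE sZ.
  rewrite add0n in mle => le1.
  have Z0 : ~: Z = set0 by apply/eqP; rewrite -cards_eq0; lia.
  exists f => x y xy; have [|//] := cov x y _ xy.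
  apply/negPn/negP => xZ; have : x \in ~: Z by rewrite inE.
  by rewrite Z0 inE.
(* On an empty stack the path condition is vacuous, so this case covers both a new child of the top
   and a new root. *)
have [/existsP[w /and3P[wZ ws ps]]|/existsPn nw] :=
    boolP [exists w, [&& w \notin Z, w \notin s & path (adj F) w s]].
  (* On an empty stack the default of [head] makes the root [w] its own parent. *)
  pose f' z := if z == w then head w s else f z.
  have f'E z : (z \in Z) || (z \in s) -> f' z = f z.
    by rewrite /f'; case: eqP => // ->; rewrite (negbTE wZ) (negbTE ws).
  apply: (IH Z (w :: s) f').
  - by rewrite /= ws.
  - by move=> x; rewrite inE => /orP[/eqP->//|/sZ].
  - by [].
  - have : sorted (frel f') s.
      have ff : {in mem s &, frel f' =2 frel f}.
        by move=> x y xs ys /=; rewrite f'E // [x \in s]xs orbT.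
      by rewrite (eq_in_sorted ff) //; apply/allP => x.
    case: (s) @f' {f'E} => //= u s' ->; by rewrite eqxx eqxx.
  - move=> x; rewrite !inE /f'; case: eqP => [_ _|_] /=.
      by case: (s) => [|u s'] /=; rewrite ?inE eqxx ?orbT.
    by move=> /cl /orP[]->; rewrite ?orbT.
  - move=> x y xZ xy; have [ys [j jn h]] := cov x y xZ xy; split.
      by rewrite inE; case/orP: ys => ->; rewrite ?orbT.
    by exists j => //; rewrite !(eq_in_iter (f := f) (W := fun z => (z \in Z) || (z \in s))) ?xZ.
  - by rewrite /= addnS -addSn.
case: s => [|u s] in us sZ ss sf cl cov mle nw *.
  exists f => x y xy; have [|//] := cov x y _ xy.
  by have := nw x; rewrite andbT negbK.
have uZ : u \notin Z by apply: sZ; rewrite mem_head.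
have sn := path_size us ss.
apply: (IH (u |: Z) s f).
- by case/andP: us.
- move=> x xs; rewrite in_setU1 negb_or sZ ?inE ?xs ?orbT // andbT.
  by apply: contraTneq xs => ->; case/andP: us.
- by move: ss => /= /path_sorted.
- by move: sf => /= /path_sorted.
- by move=> x; have := cl x; rewrite !inE -!orbA ![(_ == u) || (_ || _)]orbCA.
- move=> x y; rewrite in_setU1 => /orP[/eqP->|xZ] xy; last first.
    by have [h1 h2] := cov x y xZ xy; split=> //; move: h1; rewrite !inE -!orbA orbCA.
  have [yZ|yZ] := boolP (y \in Z).
    have [|_ [j jn [h|h]]] := cov y u yZ; first by rewrite adj_sym.
      by split; [rewrite !inE yZ orbT | exists j => //; right].
    by split; [rewrite !inE yZ orbT | exists j => //; left].
  have ys : y \in u :: s.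
    apply/negPn/negP => ys; have := nw y.
    by rewrite yZ ys /= adj_sym xy; move: ss => /= ->.
  have {}ys : y \in s.
    by move: ys; rewrite inE eq_sym (negbTE (adj_neq xy)).
  split; first by rewrite ys orbT.
  (* A neighbour still on the stack is an ancestor: the stack below [u] is the trajectory of [u]
     under [f], and being part of a path of [F] it has fewer than n vertices. *)
  have /fpathP[r sE] : fpath f u s by [].
  have jr : index y s < r by move: ys; rewrite -index_mem {2}sE size_traject.
  exists (index y s); first by rewrite -index_mem in ys; apply: leq_trans ys (ltnW sn).
  left; rewrite iterSr -(nth_traject _ jr) -sE nth_index //.
- rewrite setCU setIC -setDE; move: mle; rewrite (cardsD1 u (~: Z)) inE uZ /=.
  by rewrite mulnDr addSn addnS add2n !ltnS.
Qed.

Definition ancestor_pairs (f : 'I_N -> 'I_N) : {set {set 'I_N}} :=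
  [set [set q.1; iter q.2.+1 f q.1] | q : 'I_N * 'I_n].

Lemma card_ancestor_pairs f : #|ancestor_pairs f| <= n * N.
Proof.
apply: leq_trans (leq_imset_card _ _) _.
by rewrite cardT -cardE card_prod !card_ord mulnC.
Qed.

(** The finite function type has N^N elements, which is what the union bound counts. *)
Lemma dfs_forest : exists f : {ffun 'I_N -> 'I_N}, F \subset ancestor_pairs f.
Proof.
have [|||||||f fP] := @dfs_complete (2 * N) set0 [::] id => //.
- by move=> x y; rewrite inE.
- by rewrite addn0 leq_mul2l /= -[X in _ <= X]card_ord max_card.
exists (finfun f); apply/subsetP => e /edgeP[x [y [-> /fP[j jn h]]]].
have fE z : iter j.+1 (finfun f) z = iter j.+1 f z.
  by apply: eq_iter => a; rewrite ffunE.
apply/imsetP; case: h => <-.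
  by exists (x, Ordinal jn); rewrite //= -[f _]/(iter j.+1 f x) -fE.
by exists (y, Ordinal jn); rewrite //= setUC -[f _]/(iter j.+1 f y) -fE.
Qed.

End Paths.
Lemma ex_path_ge (N k : nat) (E F : {set {set 'I_N}}) :
  F \subset E -> ~~ contains_path F k -> (#|F| <= ex_path E k)%N.
Proof.
move=> FE nF; rewrite /ex_path.
by apply: (leq_bigmax_cond (F := fun F0 : {set {set 'I_N}} => #|F0|)); rewrite powersetE FE.
Qed.

Lemma ex_path_le (R : realType) (N k : nat) (E : {set {set 'I_N}}) (m : R) : 0 <= m ->
    (forall F : {set {set 'I_N}}, F \subset E -> ~~ contains_path F k -> #|F|%:R <= m) ->
  (ex_path E k)%:R <= m.
Proof.
move=> m0 h; rewrite /ex_path; elim/big_ind: _ => // [x y hx hy|F].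
  by rewrite /maxn; case: ifP.
by rewrite powersetE => /andP[]; apply: h.
Qed.

(** * Star forests in the random graph *)

Section Stars.
Variables (N k d b : nat) (a : 'I_k * 'I_d * 'I_b -> 'I_N).
Hypothesis a_inj : injective a.
Let centers := [set a q | q : 'I_k * 'I_d * 'I_b].
Let B := ~: centers.

(* The centers form [k] groups of [d] blocks of [b] vertices. A leaf is good if it
   has a neighbour in every block of some group; it then keeps [d] edges to that
   group. Blocks replace the binomial tail by a product of probabilities. *)
Definition block (v : 'I_N) (i : 'I_k) (j : 'I_d) (E : {set {set 'I_N}}) :=
  [exists l : 'I_b, [set v; a (i, j, l)] \in E].
Definition group v i E := [forall j, block v i j E].
Definition good v E := [exists i, group v i E].

Lemma mem_center q : a q \in centers.
Proof. exact: imset_f. Qed.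

Lemma mem_leaf v : v \in B -> v \notin centers.
Proof. by rewrite inE. Qed.

Lemma card_leaves : #|B| = (N - k * d * b)%N.
Proof.
by rewrite cardsCs setCK card_ord card_imset // ?cardsT !card_prod !card_ord.
Qed.

Lemma leaf_edge_inj v v' y y' : v \in B -> v' \in B -> y \in centers -> y' \in centers ->
  [set v; y] = [set v'; y'] -> v = v' /\ y = y'.
Proof.
move=> /mem_leaf vB /mem_leaf v'B yc y'c /setP h.
have hv := h v; have hy := h y; rewrite !inE !eqxx /= ?orbT in hv hy.
move: hv hy; case: (eqVneq v v') => [->|_ /= /esym/eqP vy'] _; last by rewrite vy' y'c in vB.
by case: (eqVneq y v') => [yv'|_ /= /esym/eqP //]; rewrite -yv' yc in v'B.
Qed.

Lemma size_alternating (C : pred 'I_N) (e : rel 'I_N) x s :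
    (forall y z, e y z -> C y || C z) -> path e x s ->
  (size (x :: s) <= 2 * count C (x :: s) + ~~ C x)%N.
Proof.
move=> eC; elim: s x => [|y s IH] x /=; first by case: (C x).
move=> /andP[/eC xy /IH] /=; case: (C x) (C y) xy => [] [] //=; lia.
Qed.

Lemma path_const (X : eqType) (c : 'I_N -> X) (e : rel 'I_N) x s :
  (forall y z, e y z -> c y = c z) -> path e x s -> {in x :: s, forall y, c y = c x}.
Proof.
move=> ec; elim: s x => [|y s IH] x /=; first by move=> _ z; rewrite inE => /eqP->.
by move=> /andP[/ec xy /IH h] z; rewrite inE => /orP[/eqP->//|/h]; rewrite xy.
Qed.

(** A path keeps one color, so it meets at most db centers; no two consecutive vertices avoid the
    centers, so it has at most 2db + 1 <= n vertices. *)
Lemma star_forest_path_free n (F : {set {set 'I_N}}) (c : 'I_N -> option 'I_k) :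
    (2 * (d * b) < n)%N -> (forall i j l, c (a (i, j, l)) = Some i) ->
    (forall x y, adj F x y -> c x = c y /\ (x \in centers) || (y \in centers)) ->
  ~~ contains_path F n.+1.
Proof.
move=> dbn ca Fc; apply/existsPn => t; apply/negP => /andP[ut st].
case: t st ut => -[|x s] //= /eqP[szs] ps /andP[xs us].
have cc := path_const (fun y z h => (Fc y z h).1) ps.
have ub := size_alternating (C := [in centers]) (fun y z h => (Fc y z h).2) ps.
have [cnt0|cnt0] := posnP (count [in centers] (x :: s)).
  by move: ub; rewrite cnt0 /= szs; case: (_ \in _) => /=; lia.
have : has [in centers] (x :: s) by rewrite has_count.
case/hasP => z zs /imsetP[[[i j] l] _ zE].
have cx : c x = Some i by rewrite -(cc z zs) zE ca.
suff : (count [in centers] (x :: s) <= d * b)%N.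
  by move: ub; rewrite /= szs; case: (_ \in _) => /=; lia.
rewrite -size_filter.
have uf : uniq [seq y <- x :: s | y \in centers] by rewrite filter_uniq //= xs.
rewrite -(card_uniqP uf).
have -> : (d * b)%N = #|{: 'I_d * 'I_b}| by rewrite card_prod !card_ord.
rewrite -cardsT; apply: leq_trans (leq_imset_card (fun q => a (i, q.1, q.2)) _).
apply: subset_leq_card; apply/subsetP => y; rewrite mem_filter => /andP[].
move=> /imsetP[[[i' j'] l'] _ yE] /cc; rewrite cx yE ca => -[->].
by apply/imsetP; exists (j', l').
Qed.

(** Each good leaf selects one group and one neighbour in each of its blocks. Blocks are disjoint,
    so these are [d] distinct edges; coloring the leaf by its group makes the selected graph
    path-free. *)
Lemma stars_ex_path n (E : {set {set 'I_N}}) : (2 * (d * b) < n)%N ->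
  (d * #|[set v in B | good v E]| <= ex_path E n.+1)%N.
Proof.
move=> dbn; set X := [set v in B | good v E].
have : forall v, exists hi : ('I_d -> 'I_N) * option 'I_k, v \in X ->
    exists i, hi.2 = Some i /\ forall j, exists l, hi.1 j = a (i, j, l) /\ [set v; hi.1 j] \in E.
  move=> v; have [vX|vX] := boolP (v \in X); last by exists (fun=> v, None).
  move: vX; rewrite inE => /andP[_ /existsP[i /forallP gi]].
  have /choice[lam lamP] : forall j, exists l, [set v; a (i, j, l)] \in E.
    by move=> j; apply/existsP/gi.
  exists (fun j => a (i, j, lam j), Some i) => _; exists i; split => // j.
  by exists (lam j); split => //; apply: lamP.
case/choice => hi hiP; pose h v := (hi v).1.
have hc v j : v \in X -> h v j \in centers.
  by move=> /hiP[i [_ /(_ j)[l [hj _]]]]; rewrite /h hj; apply: mem_center.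
have XB v : v \in X -> v \in B by rewrite inE => /andP[].
pose F := [set [set q.1; h q.1 q.2] | q in setX X [set: 'I_d]].
have cardF : #|F| = (d * #|X|)%N.
  rewrite card_in_imset ?cardsX ?cardsT ?card_ord ?(mulnC d) // => -[v j] [v' j'].
  rewrite !in_setX => /andP[/= vX _] /andP[/= v'X _].
  case/(leaf_edge_inj (XB _ vX) (XB _ v'X) (hc _ j vX) (hc _ j' v'X)) => vv'.
  rewrite -vv' => hj; congr (_, _).
  have [i [_ hiv]] := hiP v vX.
  by move: hj; rewrite /h; case: (hiv j) => l [-> _]; case: (hiv j') => l' [-> _] /a_inj[].
rewrite -cardF; apply: ex_path_ge.
  apply/subsetP => e /imsetP[[v j]]; rewrite in_setX => /andP[/= vX _] ->.
  by have [i [_ /(_ j)[l []]]] := hiP v vX.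
pose c x := if [pick q | a q == x] is Some q then Some q.1.1 else (hi x).2.
have ca i j l : c (a (i, j, l)) = Some i.
  rewrite /c; case: pickP => [q /eqP/a_inj-> //|/(_ (i, j, l))]; by rewrite eqxx.
have cX v j : v \in X -> c v = c (h v j).
  move=> vX; have [i [hi2 /(_ j)[l [hj _]]]] := hiP v vX.
  rewrite /h hj ca /c; case: pickP => [q /eqP qv|_ //].
  by have := mem_leaf (XB _ vX); rewrite -qv mem_center.
apply: (star_forest_path_free dbn ca) => x y /imsetP[[v j]].
rewrite in_setX => /andP[/= vX _] xy.
have hx : x \in [set v; h v j] by rewrite -xy !inE eqxx.
have hy : y \in [set v; h v j] by rewrite -xy !inE eqxx orbT.
have hv : v \in [set x; y] by rewrite xy !inE eqxx.
have hh : h v j \in [set x; y] by rewrite xy !inE eqxx orbT.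
have vh : v != h v j.
  by apply: contraTneq (hc v j vX) => <-; apply: mem_leaf; apply: XB.
move: hx hy hv hh; rewrite !inE => /orP[] /eqP-> /orP[] /eqP->.
- by rewrite orbb => _; rewrite orbb eq_sym (negbTE vh).
- by move=> _ _; rewrite (cX v j) // hc ?orbT.
- by move=> _ _; rewrite (cX v j) // hc.
- by rewrite orbb (negbTE vh).
Qed.

Lemma insens_mem (e e' : {set 'I_N}) : e != e' -> insens (fun E => e' \in E) e.
Proof. by move=> ee E; rewrite in_setU1 eq_sym (negbTE ee). Qed.

Lemma insens_block v i j e : (forall l, e != [set v; a (i, j, l)]) -> insens (block v i j) e.
Proof. by move=> h E; apply: eq_existsb => l; rewrite insens_mem. Qed.

Lemma insens_group v i e : (forall j l, e != [set v; a (i, j, l)]) -> insens (group v i) e.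
Proof. by move=> h E; apply: eq_forallb => j; rewrite insens_block. Qed.

Lemma insens_good v e : (forall q, e != [set v; a q]) -> insens (good v) e.
Proof. by move=> h E; apply: eq_existsb => i; rewrite insens_group. Qed.

Section Prob.
Variables (R : realType) (p : R).
Let K := enum (Kedges N).

Lemma prob_block v i j : v \in B -> prob p K (block v i j) = 1 - (1 - p) ^+ b.
Proof.
move=> vB; rewrite prob_exists => [|e l l' ll'].
  under eq_bigr => l _.
    rewrite prob_mem ?enum_uniq // mem_enum inE cards2.
    have -> : v != a (i, j, l).
      by apply: contraTneq (mem_center (i, j, l)) => <-; apply: mem_leaf.
    over.
  by rewrite prodr_const card_ord.
have [->|ne] := eqVneq e [set v; a (i, j, l)]; last by left; apply: insens_mem.
right; apply: insens_mem; apply: contraNneq ll' => h.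
by have [_ /a_inj[->]] := leaf_edge_inj vB vB (mem_center _) (mem_center _) h.
Qed.

Lemma prob_group v i : v \in B -> prob p K (group v i) = (1 - (1 - p) ^+ b) ^+ d.
Proof.
move=> vB; rewrite prob_forall => [|e j j' jj'].
  by under eq_bigr do rewrite prob_block //; rewrite prodr_const card_ord.
have [[l el]|ne] := pselect (exists l, e = [set v; a (i, j, l)]); last first.
  by left; apply: insens_block => l; apply/eqP => el; apply: ne; exists l.
right; apply: insens_block => l'; apply: contraNneq jj'; rewrite el => h.
by have [_ /a_inj[->]] := leaf_edge_inj vB vB (mem_center _) (mem_center _) h.
Qed.

Lemma prob_good v : v \in B ->
  prob p K (good v) = 1 - (1 - (1 - (1 - p) ^+ b) ^+ d) ^+ k.
Proof.
move=> vB; rewrite prob_exists => [|e i i' ii'].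
  by under eq_bigr do rewrite prob_group //; rewrite prodr_const card_ord.
have [[j [l el]]|ne] := pselect (exists j l, e = [set v; a (i, j, l)]); last first.
  by left; apply: insens_group => j l; apply/eqP => el; apply: ne; exists j, l.
right; apply: insens_group => j' l'; apply: contraNneq ii'; rewrite el => h.
by have [_ /a_inj[->]] := leaf_edge_inj vB vB (mem_center _) (mem_center _) h.
Qed.

(** Markov's inequality for 2^(-X), with X the number of good leaves. Distinct leaves read disjoint
    pairs, so the mean factors into terms 1 - q/2 = (1 + (1 - q))/2, with q the probability of being
    good. *)
Lemma prob_few_good (t : nat) : 0 <= p <= 1 ->
  prob p K (fun E => #|[set v in B | good v E]| < t)%N <=
  2 ^+ t * ((1 + (1 - (1 - (1 - p) ^+ b) ^+ d) ^+ k) / 2) ^+ (N - k * d * b).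
Proof.
move=> p01.
apply: (@le_trans _ _ (2 ^+ t * expect p K (fun E => \prod_(v in B) (1 - (good v E)%:R / 2)))).
  rewrite -expectZ; apply: expect_le => // E.
  have -> : \prod_(v in B) (1 - (good v E)%:R / 2) = 2^-1 ^+ #|[set v in B | good v E]| :> R.
    rewrite -[RHS]prodr_const [LHS](bigID (fun v => good v E)) /=.
    rewrite [X in _ * X]big1 => [|v /andP[_ /negbTE ->]]; last by rewrite mul0r subr0.
    rewrite mulr1; apply: eq_big => [v|v /andP[_ ->]]; first by rewrite [RHS]in_set.
    by rewrite -[true%:R]/(1 : R); field.
  case: ltnP => h; last by rewrite mulr_ge0 ?exprn_ge0 ?invr_ge0.
  rewrite exprVn ler_pdivlMr ?exprn_gt0 // mul1r.
  by rewrite ler_eXn2l ?ltr1n // ltnW.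
rewrite ler_wpM2l ?exprn_ge0 //.
rewrite (@eq_expect _ _ _ _ _ (fun E => \prod_(v <- enum B) (1 - (good v E)%:R / 2))); last first.
  by move=> E; rewrite big_enum.
rewrite expect_prod ?enum_uniq //; last first.
  move=> e v v'; rewrite !mem_enum => vB v'B vv'.
  have [[q el]|ne] := pselect (exists q, e = [set v; a q]); last first.
    left => E; rewrite insens_good // => q; apply/eqP => el; apply: ne; by exists q.
  right => E; rewrite insens_good // => q'; apply: contraNneq vv'; rewrite el => h.
  by have [->] := leaf_edge_inj vB v'B (mem_center _) (mem_center _) h.
rewrite big_enum /= -card_leaves -prodr_const.
rewrite le_eqVlt; apply/orP; left; apply/eqP; apply: eq_bigr => v vB.
rewrite (@eq_expect _ _ _ _ _ (fun E => 1 + (- 2^-1) * (good v E)%:R)); last first.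
  by move=> E; rewrite mulNr mulrC.
rewrite expectD expect_cst expectZ -/(prob p K (good v)) prob_good //.
by field.
Qed.

End Prob.

End Stars.

(** * Transfer to G(N,p) *)

Lemma Gnp_probE (R : realType) (N : nat) (p : R) (A : pred {set {set 'I_N}}) :
  Gnp_prob N p A = prob p (enum (Kedges N)) A.
Proof.
rewrite /prob expect_sum ?enum_uniq // /Gnp_prob -cardE.
rewrite big_mkcondr; apply: eq_big => [E|E _].
  by rewrite powersetE; apply: eq_subset_r => e; rewrite mem_enum.
by case: (A E); rewrite ?mulr1 ?mulr0.
Qed.

Lemma prob_Kedges (R : realType) (N : nat) (p : R) (A : pred {set {set 'I_N}}) :
  prob p (enum (Kedges N)) (fun E => (E \subset Kedges N) && A E) =
  prob p (enum (Kedges N)) A.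
Proof.
rewrite -!Gnp_probE /Gnp_prob; apply: eq_bigl => E.
by rewrite powersetE andbA andbb.
Qed.

Lemma prob_ex_path_lt (R : realType) (p c : R) (N n k d b t : nat) : 0 <= p <= 1 ->
    (2 * (d * b) < n)%N -> (k * d * b <= N)%N ->
    (1 - (1 - (1 - p) ^+ b) ^+ d) ^+ k <= c ->
  prob p (enum (Kedges N)) (fun E => ex_path E n.+1 < d * t)%N <=
  2 ^+ t * ((1 + c) / 2) ^+ (N - k * d * b).
Proof.
move=> p01 dbn kdbN qc.
have szX : #|{: 'I_k * 'I_d * 'I_b}| = (k * d * b)%N by rewrite !card_prod !card_ord.
have rN (q : 'I_k * 'I_d * 'I_b) : (enum_rank q < N)%N.
  by apply: leq_trans (ltn_ord _) _; rewrite szX.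
pose a q := Ordinal (rN q).
have a_inj : injective a by move=> q q' [] /ord_inj/enum_rank_inj.
pose X E := [set v in ~: [set a q | q : 'I_k * 'I_d * 'I_b] | good a v E].
have hX := prob_few_good a_inj t p01.
apply: (@le_trans _ _ (prob p (enum (Kedges N)) (fun E => #|X E| < t)%N)).
  apply: prob_le => // E; have := stars_ex_path a_inj E dbn.
  by rewrite -/(X E) => h1 h2; have := leq_ltn_trans h1 h2; rewrite ltn_mul2l => /andP[].
apply: (le_trans hX).
have [p0 p1] := andP p01.
have h0 : 0 <= 1 - (1 - p) ^+ b by rewrite subr_ge0 exprn_ile1 ?subr_ge0 // gerBl.
have h1 : 1 - (1 - p) ^+ b <= 1 by rewrite gerBl exprn_ge0 // subr_ge0.
have h2 : 0 <= 1 - (1 - (1 - p) ^+ b) ^+ d by rewrite subr_ge0 exprn_ile1.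
rewrite ler_wpM2l ?exprn_ge0 // lerXn2r ?nnegrE ?divr_ge0 ?addr_ge0 ?exprn_ge0 //.
- by apply: le_trans qc; rewrite exprn_ge0.
- by rewrite ler_pM2r ?invr_gt0 // lerD2l.
Qed.

(* Every path-free graph lies in the ancestor pairs of one of [N ^ N] parent functions. *)
Lemma prob_ex_path_gt (R : realType) (p y m : R) (N n : nat) : 0 <= p <= 1 ->
    1 <= y -> 0 <= m ->
  prob p (enum (Kedges N)) (fun E => m < (ex_path E n.+1)%:R) <=
  (N ^ N)%:R * (y `^ (- m) * expR (y * p * (n * N)%:R)).
Proof.
move=> p01 y1 m0; rewrite -prob_Kedges.
apply: (@le_trans _ _ (prob p (enum (Kedges N)) (fun E =>
    [exists f : {ffun 'I_N -> 'I_N}, m <= #|E :&: ancestor_pairs n f|%:R]))).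
  apply: prob_le => // E /andP[EK]; apply: contraTT => /existsPn hf; rewrite -leNgt.
  apply: ex_path_le => // F FE nP.
  have [f Ff] := dfs_forest (subset_trans FE EK) nP.
  have := hf f; rewrite -ltNge => /ltW; apply: le_trans.
  by rewrite ler_nat subset_leq_card // subsetI FE.
apply: le_trans (prob_exists_le _ _ p01) _.
have -> : (N ^ N)%:R = \sum_(f : {ffun 'I_N -> 'I_N}) 1 :> R.
  by rewrite sumr_const card_ffun !card_ord.
rewrite mulr_suml; apply: ler_sum => f _; rewrite mul1r.
apply: le_trans (prob_card_ge _ _ p01 (enum_uniq _) y1) _.
rewrite ler_wpM2l ?powR_ge0 // ler_expR ler_wpM2l //.
  by rewrite mulr_ge0 ?(le_trans ler01 y1) //; case/andP: p01.
by rewrite ler_nat card_ancestor_pairs.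
Qed.
(** * Choice of parameters *)

Section Estimates.
Variable R : realType.
Implicit Types (p x y L : R) (n M k d b t : nat).

Lemma expR_ge_sqr x : 0 <= x -> x ^+ 2 / 4 <= expR x.
Proof.
move=> x0; have -> : x = x / 2 + x / 2 by field.
rewrite expRD; have := expR_ge1Dx (x / 2); nra.
Qed.

Lemma expRN_le x : 0 <= x -> expR (- x) <= (1 + x)^-1.
Proof.
move=> x0; rewrite expRN lef_pV2 ?posrE ?expR_gt0 ?expR_ge1Dx //; lra.
Qed.

(** Goes through e^(-ky) <= e^(-x); the rational bound avoids numerical values of the
    exponential. *)
Lemma pow_compl_le k y x : 0 <= y <= 1 -> 0 <= x -> x <= k%:R * y ->
  (1 - y) ^+ k <= (1 + x)^-1.
Proof.
move=> /andP[y0 y1] x0 xk; apply: le_trans (expRN_le x0).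
apply: (@le_trans _ _ (expR (- (k%:R * y)))); last by rewrite ler_expR lerN2.
rewrite -mulrN expRM_natl lerXn2r ?nnegrE ?expR_ge0 ?subr_ge0 //.
by have := expR_ge1Dx (- y).
Qed.

Lemma pow_eventually_le (eps : R) : 0 < eps -> exists n0, forall n t,
  (n0 <= n)%N -> (n <= 64 * t)%N -> (18 / 25) ^+ t <= eps.
Proof.
move=> eps0; exists (Num.truncn (400 / eps)).+1 => n t n0n nt.
have h1 : (18 / 25 : R) ^+ t <= (1 + t%:R * (7 / 25))^-1.
  have -> : 18 / 25 = 1 - 7 / 25 :> R by field.
  by apply: pow_compl_le; rewrite ?mulr_ge0 //; lra.
have h0 : 0 < 1 + t%:R * (7 / 25) :> R by have : 0 <= t%:R :> R by []; lra.
apply: le_trans h1 _; rewrite invf_ple ?posrE //.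
have h2 : 400 / eps < n%:R.
  by apply: lt_le_trans (truncnS_gt _) _; rewrite ler_nat.
have h3 : n%:R <= 64 * t%:R :> R by rewrite -natrM ler_nat.
have : 400 * eps^-1 < 64 * t%:R by apply: lt_le_trans h2 h3.
have : 0 < eps^-1 by rewrite invr_gt0.
lra.
Qed.

(** At least half of the vertices are leaves. If at least 4 groups succeed on average, a leaf fails
    with probability at most 1/5, and each demanded leaf costs a factor 2 (3/5)^2 = 18/25. If the
    average is only 1/4, it fails with probability at most 4/5; then t <= M/32 gives 2 (9/10)^16,
    below 18/25. *)
Lemma prob_ex_path_lt_pow p n M k d b t : 0 <= p <= 1 ->
    (2 * (d * b) < n)%N -> (2 * (k * d * b) <= M)%N ->
    (4 <= k%:R * (1 - (1 - p) ^+ b) ^+ d) && (4 * t <= M)%N ||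
    (1 / 4 <= k%:R * (1 - (1 - p) ^+ b) ^+ d) && (32 * t <= M)%N ->
  prob p (enum (Kedges M)) (fun E => ex_path E n.+1 < d * t)%N <= (18 / 25) ^+ t.
Proof.
move=> p01 dbn kM h.
have kM' : (k * d * b <= M)%N by lia.
have [p0 p1] := andP p01.
have y01 : 0 <= (1 - (1 - p) ^+ b) ^+ d <= 1.
  have hb : 0 <= 1 - (1 - p) ^+ b <= 1.
    by rewrite subr_ge0 gerBl exprn_ile1 ?exprn_ge0 ?subr_ge0 // gerBl.
  by case/andP: hb => *; rewrite exprn_ge0 // exprn_ile1.
have powle (z : R) (i : nat) : 0 <= z <= 1 -> (i * t <= M - k * d * b)%N ->
    2 ^+ t * z ^+ (M - k * d * b) <= (2 * z ^+ i) ^+ t.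
  move=> /andP[z0 z1] hi; rewrite exprMn ler_wpM2l ?exprn_ge0 // -exprM.
  by rewrite ler_wiXn2l.
case/orP: h => /andP[hk hM].
  have := pow_compl_le y01 (ler0n _ _) hk.
  have -> : (1 + 4)^-1 = 1 / 5 :> R by field.
  move=> hc.
  apply: le_trans (prob_ex_path_lt _ p01 dbn kM' hc) _.
  apply: le_trans (powle _ 2 _ _) _; [apply/andP; split; lra | lia |].
  by rewrite lerXn2r ?nnegrE ?mulr_ge0 ?exprn_ge0 //; lra.
have q0 : 0 <= 1 / 4 :> R by lra.
have := pow_compl_le y01 q0 hk.
have -> : (1 + 1 / 4)^-1 = 4 / 5 :> R by field.
move=> hc.
apply: le_trans (prob_ex_path_lt _ p01 dbn kM' hc) _.
apply: le_trans (powle _ 16 _ _) _; [apply/andP; split; lra | lia |].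
have h4 : ((1 + 4 / 5) / 2 : R) ^+ 4 <= 2 / 3 by lra.
have h16 : ((1 + 4 / 5) / 2 : R) ^+ 16 <= 16 / 81.
  rewrite -[16%N]/(4 * 4)%N exprM; have -> : 16 / 81 = (2 / 3 : R) ^+ 4 by field.
  by rewrite lerXn2r ?nnegrE ?exprn_ge0 //; lra.
rewrite lerXn2r ?nnegrE ?mulr_ge0 ?exprn_ge0 //; lra.
Qed.

Lemma ln_ge n M : (0 < n)%N -> n%:R * expR (2 * n%:R) <= M%:R :> R ->
  2 * n%:R <= ln (M%:R : R).
Proof.
move=> n0 h; rewrite -[leLHS]expRK ler_ln ?posrE ?expR_gt0 //.
  apply: le_trans h; rewrite ler_peMl ?expR_ge0 // ler1n //.
by apply: lt_le_trans h; rewrite mulr_gt0 ?expR_gt0 // ltr0n.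
Qed.

Lemma expR_lnM n M : (0 < n)%N -> 2 * n%:R <= ln (M%:R : R) -> expR (ln (M%:R : R)) = M%:R.
Proof.
case: M => [|M] n0 h; last by rewrite lnK // posrE ltr0n.
(* As [ln 0] is 0 by convention, the lower bound on [ln] excludes [M = 0]. *)
move: h; rewrite ln0 // => h.
have : 0 < n%:R :> R by rewrite ltr0n.
lra.
Qed.

Lemma natM_ge n M : (0 < n)%N -> 2 * n%:R <= ln (M%:R : R) -> (n ^ 2 <= M)%N.
Proof.
move=> n0 h; rewrite -(ler_nat R) -(expR_lnM n0 h) natrX.
apply: (@le_trans _ _ (expR (2 * n%:R))); last by rewrite ler_expR.
have := @expR_ge_sqr (2 * n%:R); rewrite mulr_ge0 // => /(_ isT).
by apply: le_trans; rewrite exprMn; lra.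
Qed.

(** Up to rounding, ky >= sqrt M / n, and sqrt M >= e^n >= n^2/4 exceeds 16n. The slack between 16
    and 4 absorbs the rounding. *)
Lemma groups_enough n M k y : (100 <= n)%N -> 2 * n%:R <= ln (M%:R : R) ->
  (M < n * k.+1)%N -> expR (- (ln (M%:R : R) / 2)) <= y -> 4 <= k%:R * y.
Proof.
move=> n100 h Mk hy; set L := ln M%:R in h hy.
have n0 : (0 < n)%N by lia.
have ME : M%:R = expR (L / 2) * expR (L / 2).
  by rewrite -expRD -splitr (expR_lnM n0 h).
have nk : M%:R <= n%:R * k%:R + n%:R :> R by rewrite -natrM -natrD ler_nat; lia.
have e0 := expR_gt0 (L / 2).
have he : 16 * n%:R <= expR (L / 2).
  apply: le_trans (_ : expR n%:R <= _); last by rewrite ler_expR; lra.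
  apply: le_trans (expR_ge_sqr _) => //.
  have : 100 <= n%:R :> R by rewrite (ler_nat _ 100).
  nra.
have k0 : 0 <= k%:R :> R by [].
have n1 : 0 < n%:R :> R by rewrite ltr0n.
rewrite expRN in hy.
apply: le_trans (_ : k%:R * (expR (L / 2))^-1 <= _); last by rewrite ler_wpM2l.
rewrite ler_pdivlMr // -(ler_pM2l n1); rewrite ME in nk.
have h1 : 16 * n%:R * expR (L / 2) <= expR (L / 2) * expR (L / 2) by rewrite ler_pM2r.
have h2 : n%:R * 1 <= n%:R * expR (L / 2).
  rewrite ler_pM2l //; apply: le_trans he.
  have : 1 <= n%:R :> R by rewrite ler1n.
  lra.
lra.
Qed.

Lemma prob_ex_path_lower1 p n M : (100 <= n)%N -> 2 * n%:R <= ln (M%:R : R) ->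
    0 < p <= 1 -> (M%:R : R) `^ (- (2 / (5 * n%:R))) <= p ->
  exists d t, [/\ (n <= 64 * t)%N, 1 / 16 * n%:R * M%:R <= (d * t)%:R :> R &
    prob p (enum (Kedges M)) (fun E => ex_path E n.+1 < d * t)%N <= (18 / 25) ^+ t].
Proof.
move=> n100 h /andP[p0 p1] hp.
have n0 : (0 < n)%N by lia.
have nM := natM_ge n0 h.
have M1 : (100 * n <= M)%N by nia.
(* Blocks of one vertex suffice here. The product dt is close to nM/8, which leaves ample room above
   nM/16. *)
pose d := (n.-1)./2; pose t := (M %/ 4)%N; pose k := (M %/ (2 * d))%N.
have dn : (2 * d < n)%N by rewrite /d; lia.
have dn2 : (n <= 2 * d + 2)%N by rewrite /d; lia.
have tM : (4 * t <= M)%N by rewrite /t; lia.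
have tM2 : (M <= 4 * t + 4)%N by rewrite /t; lia.
have kM : (2 * d * k <= M)%N by rewrite /k mulnC; apply: leq_trunc_div.
have kM2 : (M < 2 * d * k.+1)%N by rewrite /k mulnC; apply: ltn_ceil; lia.
exists d, t; split; first by lia.
  rewrite natrM.
  have : M%:R <= 4 * t%:R + 4 :> R by rewrite -natrM -natrD ler_nat.
  have : n%:R <= 2 * d%:R + 2 :> R by rewrite -natrM -natrD ler_nat.
  have : 100 <= n%:R :> R by rewrite (ler_nat _ 100).
  have : 100 <= M%:R :> R by rewrite (ler_nat _ 100); lia.
  have : 0 <= t%:R :> R by [].
  have : 0 <= d%:R :> R by [].
  set T : R := t%:R; set D : R := d%:R; set m : R := M%:R; set v : R := n%:R => D0 T0 m1 v1 h1 h2.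
  have hD : 49 / 100 * v <= D by lra.
  have hT : 6 / 25 * m <= T by lra.
  apply: le_trans (_ : 49 / 100 * v * (6 / 25 * m) <= _).
    have : 0 <= v * m by apply: mulr_ge0; lra.
    lra.
  by apply: ler_pM => //; lra.
apply: (@prob_ex_path_lt_pow _ _ _ k d 1 t); rewrite ?muln1 ?(ltW p0) //.
  by move: kM; rewrite -mulnA [(d * k)%N]mulnC.
rewrite tM andbT expr1 subKr; apply/orP; left.
apply: (groups_enough n100 h).
  by apply: leq_trans kM2 _; rewrite leq_mul2r; lia.
have v0 : 0 < n%:R :> R by rewrite ltr0n.
have L0 : 0 <= ln M%:R :> R by lra.
have -> : p = expR (ln p) by rewrite lnK.
rewrite -expRM_natl ler_expR.
have hp2 : - (2 / (5 * n%:R)) * ln M%:R <= ln p.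
  move: hp; rewrite /powR gt_eqF ?ltr0n; last by lia.
  by rewrite -ler_ln ?posrE ?expR_gt0 // expRK.
apply: le_trans (_ : d%:R * (- (2 / (5 * n%:R)) * ln M%:R) <= _); last by rewrite ler_wpM2l.
rewrite mulNr mulrN lerN2 mulrA.
have -> : ln M%:R / 2 = 2^-1 * ln M%:R :> R by rewrite mulrC.
rewrite ler_wpM2r // mulrA ler_pdivrMr; last by lra.
have : 2 * d%:R <= n%:R :> R by rewrite -natrM ler_nat; lia.
lra.
Qed.

Lemma sqr_bounds n M : (100 <= n)%N -> (n ^ 2 <= M)%N -> [/\ (0 < n)%N, (n <= M)%N & (100 * n <= M)%N].
Proof. by move=> h1 h2; split; nia. Qed.

Lemma half_bounds n M : (100 <= n)%N -> (n <= M)%N ->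
  [/\ (2 * (M %/ 2 * 1 * 1) <= M)%N, (M <= 2 * (M %/ 2) + 2)%N & (M < n * (M %/ 2).+1)%N].
Proof.
move=> h1 h2; have h3 : (M < 2 * (M %/ 2).+1)%N by lia.
split; [by lia | by lia | apply: leq_trans h3 _].
by rewrite leq_mul2r; apply/orP; right; lia.
Qed.

Lemma div4_bounds n M : (100 <= n)%N -> (n <= M)%N ->
  [/\ (4 * (M %/ 4) <= M)%N, (M <= 4 * (M %/ 4) + 4)%N & (n <= 64 * (M %/ 4))%N].
Proof. by move=> h1 h2; split; lia. Qed.

Lemma div32_bounds n M : (100 <= n)%N -> (n <= M)%N ->
  [/\ (32 * (M %/ 32) <= M)%N, (M <= 32 * (M %/ 32) + 32)%N & (n <= 64 * (M %/ 32))%N].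
Proof. by move=> h1 h2; split; lia. Qed.

(** As d <= s, the quotient b is at least 1 and s < d(b + 1) <= 2db: rounding loses at most a factor
    2. *)
Lemma block_bounds n d : (100 <= n)%N -> (0 < d)%N -> (16 * d <= 5 * n)%N ->
  (2 * (d * ((n.-1)./2 %/ d)) < n)%N && (n <= 4 * (d * ((n.-1)./2 %/ d)))%N.
Proof.
move=> h1 d0 h2; set s := (n.-1)./2.
have hs : (2 * s < n <= 2 * s + 2)%N by rewrite /s; lia.
have hd : (d <= s)%N by lia.
have : (s < d * (s %/ d).+1)%N by rewrite mulnC ltn_ceil.
have : (d * (s %/ d) <= s)%N by rewrite mulnC leq_trunc_div.
have : (0 < s %/ d)%N by rewrite divn_gt0.
move: (s %/ d)%N => b b0 h3 h4.
have : (d <= d * b)%N by rewrite leq_pmulr.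
by rewrite mulnS in h4; lia.
Qed.

Lemma group_bounds n M d b : (0 < d * b)%N -> (2 * (d * b) < n)%N ->
  (2 * (M %/ (2 * (d * b)) * d * b) <= M)%N && (M < n * (M %/ (2 * (d * b))).+1)%N.
Proof.
move=> db0 dbn; rewrite -mulnA mulnCA leq_trunc_div /=.
apply: leq_trans (_ : 2 * (d * b) * (M %/ (2 * (d * b))).+1 <= _)%N.
  by rewrite mulnC ltn_ceil // muln_gt0.
by rewrite leq_mul2r ltnW ?orbT.
Qed.

(** * The sparse range *)

Section Sparse.
Variables (p : R) (n M : nat).
Hypothesis n_large : (100 <= n)%N.
Hypothesis lnM : 2 * n%:R <= ln (M%:R : R).
Hypothesis p01 : 0 < p <= 1.
Let L : R := ln M%:R.
Let omega : R := L / (n%:R * p).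
Let D : R := L / ln omega.

Let n_gt0N : (0 < n)%N. Proof. exact: leq_trans n_large. Qed.
Let n_gt0 : 0 < n%:R :> R. Proof. by rewrite ltr0n. Qed.
Let p_gt0 : 0 < p. Proof. by case/andP: p01. Qed.
Let L_gt0 : 0 < L. Proof. by move: n_gt0 lnM; rewrite /L; lra. Qed.

Lemma omegaK : omega * p * n%:R = L.
Proof. by rewrite /omega; field; rewrite !gt_eqF. Qed.

Lemma omega_ge2 : 2 <= omega.
Proof.
rewrite /omega ler_pdivlMr ?mulr_gt0 //; apply: le_trans lnM.
by rewrite ler_pM2l // ler_piMr ?(ltW n_gt0) //; case/andP: p01.
Qed.

Let omega_gt0 : 0 < omega. Proof. by have := omega_ge2; lra. Qed.

Lemma ln_omega_gt0 : 0 < ln omega.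
Proof. by apply: ln_gt0; have := omega_ge2; lra. Qed.

Let D_gt0 : 0 < D. Proof. by rewrite divr_gt0 ?ln_omega_gt0. Qed.

Lemma DlnE : D * ln omega = L.
Proof. by rewrite divfK // gt_eqF ?ln_omega_gt0. Qed.

Lemma omega_D : omega / ln omega * p * n%:R = D.
Proof. by rewrite /D -omegaK; field; rewrite gt_eqF ?ln_omega_gt0. Qed.

Lemma prob_ex_path_upper :
  prob p (enum (Kedges M))
    (fun E => 8 * (omega / ln omega) * p * n%:R * M%:R < (ex_path E n.+1)%:R) <= n%:R^-1.
Proof.
have -> : 8 * (omega / ln omega) * p * n%:R * M%:R = 8 * D * M%:R.
  by rewrite -omega_D; ring.
have p01' : 0 <= p <= 1 by case/andP: p01 => /ltW -> ->.
(* With y = sqrt omega, y^(-8DM) = e^(-4ML). This beats M^M = e^(ML) and the moment e^(ypnM) <=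
   e^(ML), the latter from y <= omega and omega pn = L. *)
pose y := expR (ln omega / 2).
have lo := ln_omega_gt0.
have y1 : 1 <= y by rewrite -expR0 ler_expR; lra.
have m0 : 0 <= 8 * D * M%:R by apply: mulr_ge0 => //; apply: mulr_ge0 => //; apply: ltW.
apply: le_trans (prob_ex_path_gt _ _ p01' y1 m0) _.
have [n0 nM' _] := sqr_bounds n_large (natM_ge n_gt0N lnM).
have ME := expR_lnM n0 lnM.
have -> : (M ^ M)%:R = expR (M%:R * L) :> R by rewrite natrX -{1}ME expRM_natl.
have -> : y `^ (- (8 * D * M%:R)) = expR (- (4 * M%:R * L)).
  rewrite /powR gt_eqF ?expR_gt0 // expRK -DlnE; congr expR; by field.
rewrite -!expRD.
have yo : y <= omega by rewrite -[leRHS]lnK ?posrE // ler_expR; lra.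
have hy : y * p * (n * M)%:R <= M%:R * L.
  rewrite natrM -omegaK mulrA [leRHS]mulrC ler_wpM2r // ler_wpM2r ?(ltW n_gt0) //.
  by rewrite ler_wpM2r ?(ltW p_gt0).
have nM : n%:R <= M%:R :> R by rewrite ler_nat.
have hL : M%:R * 1 <= M%:R * L.
  rewrite ler_wpM2l //; apply: le_trans lnM.
  have : 1 <= n%:R :> R by rewrite ler1n.
  lra.
apply: le_trans (_ : expR (- n%:R) <= _).
  rewrite ler_expR -(mulrA 4); move: hy hL nM n_gt0.
  set u := y * p * _; set w := M%:R * L; set m := M%:R; set v := n%:R.
  by move: u w m v => u w m v; lra.
rewrite expRN lef_pV2 ?posrE ?expR_gt0 //.
by apply: le_trans (expR_ge1Dx _); rewrite lerDr.
Qed.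

Hypothesis p_ge : M%:R^-1 <= p.
Hypothesis p_le : p <= (M%:R : R) `^ (- (2 / (5 * n%:R))).

(** The first term, from the upper bound on p, gives D <= 5n/2. The second, from L/n >= 2 and ln 2
    >= 1/2, brings [ln omega] above 1. *)
Lemma ln_omega_ge : 2 / 5 * (L / n%:R) + 1 / 2 <= ln omega.
Proof.
have -> : omega = (L / n%:R) / p by rewrite /omega; field; rewrite !gt_eqF.
rewrite ln_div ?posrE ?divr_gt0 //.
have h2 : ln p <= - (2 / 5 * (L / n%:R)).
  have -> : - (2 / 5 * (L / n%:R)) = - (2 / (5 * n%:R)) * L by field; rewrite gt_eqF.
  move: p_le; rewrite /powR gt_eqF ?ltr0n; last first.
    by rewrite -(ltr0n R) -(expR_lnM n_gt0N lnM) expR_gt0.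
  by rewrite -ler_ln ?posrE ?expR_gt0 // expRK.
have h3 : 1 / 2 <= ln (L / n%:R).
  rewrite -[leLHS]expRK ler_ln ?posrE ?expR_gt0 ?divr_gt0 //.
  apply: le_trans (_ : 2 <= _); last by rewrite ler_pdivlMr.
  have e2 : expR (- (1 / 2)) >= 2^-1 :> R by have := expR_ge1Dx (- (1 / 2) : R); lra.
  by move: e2; rewrite expRN lef_pV2 ?posrE ?expR_gt0.
lra.
Qed.

(* [D] is the target average degree up to a constant. For [D <= 16] single edges
   ([d = 1]) suffice; for [D <= 2] the graph may be so sparse that only a constant
   fraction of the leaves has a neighbour among the centers. *)
Lemma prob_ex_path_lower2 : exists d t, [/\ (n <= 64 * t)%N,
    1 / 75 * (omega / ln omega) * p * n%:R * M%:R <= (d * t)%:R :> R &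
    prob p (enum (Kedges M)) (fun E => ex_path E n.+1 < d * t)%N <= (18 / 25) ^+ t].
Proof.
have -> : 1 / 75 * (omega / ln omega) * p * n%:R * M%:R = 1 / 75 * D * M%:R.
  by rewrite -omega_D; ring.
have p01' : 0 <= p <= 1 by case/andP: p01 => /ltW -> ->.
have p1 : p <= 1 by case/andP: p01.
have [n0 nM M1] := sqr_bounds n_large (natM_ge n_gt0N lnM).
have ME : expR L = M%:R := expR_lnM n0 lnM.
have lnL : 2 * n%:R <= L := lnM.
have M1000 : 1000 <= M%:R :> R.
  have : 100 * n%:R <= M%:R :> R by rewrite -natrM ler_nat.
  have : 100 <= n%:R :> R by rewrite (ler_nat _ 100).
  lra.
have lo := ln_omega_gt0.
have logE := ln_omega_ge.
have o2 := omega_ge2.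
have DL := DlnE.
have Ln2 : 2 <= L / n%:R by rewrite ler_pdivlMr.
pose k1 := (M %/ 2)%N.
have [k1M k1M2 k1n] := half_bounds n_large nM.
have d1n : (2 * (1 * 1) < n)%N by apply: leq_trans n_large.
have [D2|D2] := lerP D 2.
  have [tM tM2 tn] := div32_bounds n_large nM.
  exists 1%N, (M %/ 32)%N; split => //.
    rewrite mul1n; apply: le_trans (_ : 1 / 75 * 2 * M%:R <= _).
      by rewrite ler_wpM2r // ler_wpM2l //; lra.
    by move: tM2; rewrite -(ler_nat R) natrD natrM; lra.
  apply: (@prob_ex_path_lt_pow _ _ _ k1 1 1 _) => //.
  rewrite tM andbT !expr1 subKr; apply/orP; right.
  apply: le_trans (_ : k1%:R * M%:R^-1 <= _); last by rewrite ler_wpM2l.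
  rewrite ler_pdivlMr; last by lra.
  by move: k1M2; rewrite -(ler_nat R) natrD natrM -/k1; lra.
have [tM tM2 tn] := div4_bounds n_large nM.
pose t := (M %/ 4)%N; rewrite -/t in tM tM2 tn.
have {}tM2 : 16 / 75 * M%:R <= t%:R :> R.
  by move: tM2; rewrite -(ler_nat R) natrD natrM; lra.
have [D16|D16] := lerP D 16.
  exists 1%N, t; split => //.
    rewrite mul1n; apply: le_trans tM2; apply: le_trans (_ : 1 / 75 * 16 * M%:R <= _).
      by rewrite ler_wpM2r // ler_wpM2l //; lra.
    by lra.
  apply: (@prob_ex_path_lt_pow _ _ _ k1 1 1 _) => //.
  rewrite tM andbT !expr1 subKr; apply/orP; left.
  apply: (groups_enough n_large lnM k1n); rewrite -/L.
  (* D > 2 makes omega at most sqrt M, and p = L/(n omega) >= 1/omega. *)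
  have lo2 : ln omega <= L / 2.
    have : 2 * ln omega <= D * ln omega by rewrite ler_pM2r // ltW.
    by rewrite DL; lra.
  have oL : omega <= expR (L / 2) by rewrite -[leLHS]lnK ?posrE // ler_expR.
  rewrite expRN; apply: le_trans (_ : omega^-1 <= _).
    by rewrite lef_pV2 ?posrE ?expR_gt0.
  rewrite -[omega^-1]mul1r ler_pdivrMr // -(ler_pM2r n_gt0).
  have -> : p * omega * n%:R = L by rewrite -omegaK; ring.
  by move: n_gt0 lnL; lra.
(* D/16 < d <= D/8, the latter because D > 16. The lower bound and t >= 16M/75 give the constant
   1/75; the upper one gives omega^(-d) >= e^(-L/8). *)
pose d := (Num.truncn (D / 16)).+1.
have d0 : (0 < d)%N by [].
have D16' : 0 <= D / 16 by move: D_gt0; lra.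
have /andP[dl du] := truncn_itv D16'.
have dD : d%:R <= D / 8 by rewrite /d -natr1; move: dl D16; lra.
have Dn : D <= 5 / 2 * n%:R.
  have z0 : 0 < L / n%:R by lra.
  rewrite -(ler_pM2r z0).
  have -> : 5 / 2 * n%:R * (L / n%:R) = 5 / 2 * L by field; rewrite gt_eqF.
  have : D * (2 / 5 * (L / n%:R)) <= D * ln omega by rewrite ler_pM2l //; lra.
  by rewrite DL; lra.
have dn : (16 * d <= 5 * n)%N by rewrite -(ler_nat R) !natrM; move: dD Dn; lra.
have := block_bounds n_large d0 dn; set b := (_ %/ d)%N => /andP[dbn dbn4].
have db0 : (0 < d * b)%N by rewrite -(ltn_pmul2l (isT : 0 < 4)%N) muln0; apply: leq_trans dbn4.
have := group_bounds M db0 dbn; set k := (M %/ _)%N => /andP[kM kn].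
exists d, t; split => //.
  rewrite natrM; apply: le_trans (_ : D / 16 * (16 / 75 * M%:R) <= _).
    by rewrite le_eqVlt; apply/orP; left; apply/eqP; field.
  apply: ler_pM => //; last exact: ltW.
apply: (prob_ex_path_lt_pow p01' dbn kM); rewrite tM andbT; apply/orP; left.
apply: (groups_enough n_large lnM kn); rewrite -/L.
(* D ln omega = omega pn <= 4 omega pdb and d <= D/8 give bp omega >= 2 ln omega, and ln omega >=
   1. *)
have bp : 2 <= b%:R * p * omega.
  suff : ln omega <= b%:R * p * omega / 2 by have : 0 < L / n%:R; lra.
  rewrite -(ler_pM2l D_gt0) DL -omegaK.
  apply: le_trans (_ : omega * p * (4 * (d%:R * b%:R)) <= _).
    by rewrite (ler_pM2l (mulr_gt0 omega_gt0 p_gt0)) -!natrM ler_nat.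
  have -> : omega * p * (4 * (d%:R * b%:R)) = d%:R * (4 * (b%:R * p * omega)) by ring.
  have -> : D * (b%:R * p * omega / 2) = D / 8 * (4 * (b%:R * p * omega)) by field.
  rewrite ler_wpM2r //; apply: mulr_ge0 => //; apply: mulr_ge0; last exact: ltW.
  by apply: mulr_ge0 => //; apply: ltW.
have z0 : 0 < omega^-1 by rewrite invr_gt0.
have z2 : omega^-1 <= 1 / 2 by rewrite -[omega^-1]mul1r ler_pdivrMr //; lra.
have hb : omega^-1 <= 1 - (1 - p) ^+ b.
  have bp' : 2 * omega^-1 <= b%:R * p by rewrite ler_pdivrMr.
  have z20 : 0 <= 2 * omega^-1 by lra.
  have := pow_compl_le p01' z20 bp'.
  (* With z = 1/omega this says z(1 - 2z) >= 0, true as z <= 1/2. *)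
  have : (1 + 2 * omega^-1)^-1 <= 1 - omega^-1.
    rewrite -[leLHS]mul1r ler_pdivrMr; last by lra.
    by move: z0 z2; set z := omega^-1; move: z => z; nra.
  by move=> hB hA; rewrite lerBrDl -lerBrDr; apply: le_trans hA hB.
apply: le_trans (_ : (omega^-1) ^+ d <= _); last first.
  by rewrite lerXn2r ?nnegrE // ltW //; apply: lt_le_trans hb.
have -> : omega^-1 = expR (- ln omega) by rewrite expRN lnK.
rewrite -expRM_natl ler_expR mulrN lerN2.
apply: le_trans (_ : D / 8 * ln omega <= _); first by rewrite ler_wpM2r // ltW.
by rewrite mulrAC DL ler_pM2l // lef_pV2 ?posrE ?ler_nat.
Qed.

End Sparse.
End Estimates.

(** * Combining the two tails *)

Lemma Gnp_prob_ge (R : realType) (p eps : R) (M : nat) (A lo hi : pred {set {set 'I_M}}) :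
    0 <= p <= 1 -> (forall E, ~~ A E -> lo E || hi E) ->
    prob p (enum (Kedges M)) lo <= eps / 2 -> prob p (enum (Kedges M)) hi <= eps / 2 ->
  1 - eps <= Gnp_prob M p A.
Proof.
move=> p01 AC hlo hhi; rewrite Gnp_probE.
have := prob_le (enum (Kedges M)) p01 AC; rewrite prob_compl.
have := prob_or (enum (Kedges M)) lo hi p01; lra.
Qed.

Lemma prob_ex_path_gt0 (R : realType) (p : R) (n M : nat) : 0 <= p <= 1 ->
  prob p (enum (Kedges M)) (fun E => 1 / 2 * n%:R * M%:R < (ex_path E n.+1)%:R :> R) <= 0.
Proof.
move=> p01; rewrite -prob_Kedges -[leRHS](expect_cst p (enum (Kedges M)) 0).
apply: expect_le => // E; case: andP => [[EK]|//]; rewrite ltNge => /negP[].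
have u0 : 0 <= 1 / 2 * n%:R * M%:R :> R by rewrite !mulr_ge0.
apply: ex_path_le => // F FE nP.
have : (2 * #|F|)%:R <= (n * M)%:R :> R.
  by rewrite ler_nat; apply: erdos_gallai nP; apply: subset_trans EK.
by rewrite !natrM; lra.
Qed.

Theorem theorem1p5 (R : realType) (N : nat -> nat) (p : nat -> R) :
  (forall n : nat, n%:R * expR (2 * n%:R) <= (N n)%:R :> R) ->
  (forall n : nat, 0 < p n <= 1) ->
  (* (i) *)
  ((exists n1 : nat, forall n : nat, (n1 <= n)%N ->
       ((N n)%:R : R) `^ (- (2 / (5 * n%:R))) <= p n) ->
   forall eps : R, 0 < eps -> exists n0 : nat, forall n : nat, (n0 <= n)%N ->
     1 - eps <= Gnp_prob (N n) (p n)
       (fun E => (1 / 16 * n%:R * (N n)%:R <= (ex_path E n.+1)%:R :> R)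
              && ((ex_path E n.+1)%:R <= 1 / 2 * n%:R * (N n)%:R :> R)))
  /\
  (* (ii) *)
  ((exists n1 : nat, forall n : nat, (n1 <= n)%N ->
       (N n)%:R^-1 <= p n /\ p n <= ((N n)%:R : R) `^ (- (2 / (5 * n%:R)))) ->
   forall eps : R, 0 < eps -> exists n0 : nat, forall n : nat, (n0 <= n)%N ->
     let omega := ln ((N n)%:R : R) / (n%:R * p n) in
     1 - eps <= Gnp_prob (N n) (p n)
       (fun E => (1 / 75 * (omega / ln omega) * p n * n%:R * (N n)%:R
                    <= (ex_path E n.+1)%:R :> R)
              && ((ex_path E n.+1)%:R
                    <= 8 * (omega / ln omega) * p n * n%:R * (N n)%:R))).
Proof.
move=> hN hp.
have p01 n : 0 <= p n <= 1 by have /andP[/ltW-> ->] := hp n.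
split=> -[n1 hn1] eps eps0.
  have e20 : 0 < eps / 2 by rewrite divr_gt0.
  have [n2 hn2] := pow_eventually_le e20.
  exists (100 + n1 + n2)%N => n hn.
  have n100 : (100 <= n)%N by apply: leq_trans hn; rewrite -addnA leq_addr.
  have n1n : (n1 <= n)%N by apply: leq_trans hn; rewrite addnAC leq_addl.
  have n2n : (n2 <= n)%N by apply: leq_trans hn; rewrite leq_addl.
  have lnN := ln_ge (leq_trans (isT : 0 < 100)%N n100) (hN n).
  have [d [t [nt le_dt hdt]]] := prob_ex_path_lower1 n100 lnN (hp n) (hn1 n n1n).
  apply: (Gnp_prob_ge (p01 n) _ (le_trans hdt (hn2 n t n2n nt))
                      (le_trans (prob_ex_path_gt0 n _ (p01 n)) (ltW e20))).
  move=> E; rewrite negb_and -!ltNge => /orP[h|->]; last by rewrite orbT.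
  by rewrite -(ltr_nat R) (lt_le_trans h le_dt).
have e20 : 0 < eps / 2 by rewrite divr_gt0.
have [n2 hn2] := pow_eventually_le e20.
(* The last summand brings the upper tail, at most 1/n, below eps/2; [n2] does so for the lower
   tail. *)
exists (100 + n1 + n2 + (Num.truncn (2 / eps)).+1)%N => n hn; cbv zeta.
have n100 : (100 <= n)%N by apply: leq_trans hn; rewrite -!addnA leq_addr.
have n1n : (n1 <= n)%N by apply: leq_trans hn; rewrite -!addnA addnCA leq_addr.
have n2n : (n2 <= n)%N by apply: leq_trans hn; rewrite addnAC leq_addl.
have epsn : 2 / eps < n%:R.
  by apply: lt_le_trans (truncnS_gt _) _; rewrite ler_nat (leq_trans _ hn) // leq_addl.
have lnN := ln_ge (leq_trans (isT : 0 < 100)%N n100) (hN n).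
have [pge ple] := hn1 n n1n.
have [d [t [nt le_dt hdt]]] := prob_ex_path_lower2 n100 lnN (hp n) pge ple.
have hup : n%:R^-1 <= eps / 2.
  rewrite invf_ple ?posrE ?ltr0n ?(leq_trans _ n100) //.
  by rewrite invf_div ltW.
apply: (Gnp_prob_ge (p01 n) _ (le_trans hdt (hn2 n t n2n nt))
                    (le_trans (prob_ex_path_upper n100 lnN (hp n)) hup)).
move=> E; rewrite negb_and -!ltNge => /orP[h|->]; last by rewrite orbT.
by rewrite -(ltr_nat R) (lt_le_trans h le_dt).
Qed.
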